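(* There exists $\epsilon\in\mathbb{R}_{>0}$ such that for every sufficiently large $n\in\mathbb{N}$, every Sums-of-Squares (SOS) refutation of the Tseitin formula $\mathrm{TS}_n$ has monomial size at least $2^{\epsilon n}$.
   Context: Tseitin formulas: fix a family $\{G_n : n\in\mathbb{N}\}$ of constant-degree regular expander graphs, $G_n=(V,E)$ having $n$ vertices, where the degree $d$ is a constant. (Expander: there is a constant $\alpha>0$ such that in each $G_n$ every vertex set $U$ with $|U|\leq n/2$ has at least $\alpha|U|$ edges leaving it.) $\mathrm{TS}_n$ has one Boolean variable $x_e$ for each $e\in E$ and one parity constraint $\sum_{e: u\in e}x_e=1 \bmod 2$ for each $u\in V$ (when $d$ is even, this is unsatisfiable for odd $n$). It is encoded as the system of polynomial equations $\{\prod_{e: u\in e}(1-2x_e)=-1 : u\in V\}$. The constant $\epsilon$ may depend on the family. SOS proofs: with $N$ Boolean variables, polynomials are real polynomials in $2N$ commuting variables $x_1,\ldots,x_N,\bar{x}_1,\ldots,\bar{x}_N$ ($N$ pairs of twin variables); $B_N=\{x_i^2-x_i,\ \bar{x}_i^2-\bar{x}_i,\ x_i+\bar{x}_i-1 : i\in[N]\}$. Constraints $q_1\geq 0,\ldots,q_\ell\geq 0$, $p_1=0,\ldots,p_m=0$ form an indexed set $Q=\{q_1,\ldots,q_\ell,p_1,\ldots,p_m\}$ (an equation $f=g$ is identified with the polynomial $f-g$). An SOS refutation of (from) $Q$ is a formal identity $$-1=s_0+\sum_{j\in[\ell]}s_jq_j+\sum_{j\in[m]}t_jp_j+\sum_{q\in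 B_N}u_qq,$$ where each $s_j=\sum_{i=1}^{k_j}r_{i,j}^2$ is given as a sum of squares of polynomials ($j\in\{0\}\cup[\ell]$) and $t_j,u_q$ are arbitrary polynomials. Its monomial size is $\sum_{j\in\{0\}\cup[\ell]}\sum_{i=1}^{k_j}\mathrm{size}(r_{i,j})+\sum_{j\in[m]}\mathrm{size}(t_j)$, where $\mathrm{size}(p)$ is the number of (nonzero) terms of $p$. *)

(* Defs.v *)
From HB Require Import structures.
From mathcomp Require Import all_boot all_order all_algebra.
From mathcomp Require Import mpoly.

Set Implicit Arguments.
Unset Strict Implicit.
Unset Printing Implicit Defensive.

Import Order.TTheory GRing.Theory Num.Theory.

Local Open Scope ring_scope.

Record sgraph (n : nat) := SGraph {
  adj :> rel 'I_n;
  adj_sym : ssrbool.symmetric adj;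
  adj_irr : irreflexive adj }.

(* An edge is the set of its two endpoints, so that every edge is listed once
   although [adj] is a relation on ordered pairs. *)
Definition edges (n : nat) (G : sgraph n) : {set {set 'I_n}} :=
  [set e | [exists u, exists v, G u v && (e == [set u; v])]].

Definition regular (n d : nat) (G : sgraph n) : Prop :=
  forall u : 'I_n, #|[set v | G u v]| = d.

Definition edge_boundary (n : nat) (G : sgraph n) (U : {set 'I_n}) :
    {set {set 'I_n}} :=
  [set e in edges G | (e :&: U != set0) && ~~ (e \subset U)].

Definition expander (R : realFieldType) (n : nat) (alpha : R) (G : sgraph n) :
    Prop :=
  forall U : {set 'I_n}, (2 * #|U| <= n)%N ->
    alpha * #|U|%:R <= #|edge_boundary G U|%:R.

(* The 2N variables of {mpoly R[N + N]} are N pairs of twins: the first N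
   indices are the variables x_i, the last N are their twins. *)
Definition xvar (R : realFieldType) (N : nat) (i : 'I_N) : {mpoly R[N + N]} :=
  'X_(lshift N i).

Definition xbar (R : realFieldType) (N : nat) (i : 'I_N) : {mpoly R[N + N]} :=
  'X_(rshift N i).

Arguments xvar R {N} i.
Arguments xbar R {N} i.

Definition mon_size (R : realFieldType) (k : nat) (p : {mpoly R[k]}) : nat :=
  size (msupp p).

Definition sum_of_squares (R : realFieldType) (k : nat)
    (r : seq {mpoly R[k]}) : {mpoly R[k]} := \sum_(f <- r) f ^+ 2.

(* The constraints are q_j >= 0 (j in J) and p_j = 0 (j in I). A sum of squares
   s_j is given by the list of the polynomials r_{i,j} that are squared; the
   three families [sos_lift*] are the multipliers of the three kinds of
   polynomials in B_N. *)
Record sos_refutation (R : realFieldType) (N : nat) (J I : finType)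
    (q : J -> {mpoly R[N + N]}) (p : I -> {mpoly R[N + N]}) := SosRefutation {
  sos_free : seq {mpoly R[N + N]};
  sos_ineq : J -> seq {mpoly R[N + N]};
  sos_eq : I -> {mpoly R[N + N]};
  sos_liftx : 'I_N -> {mpoly R[N + N]};
  sos_liftb : 'I_N -> {mpoly R[N + N]};
  sos_liftt : 'I_N -> {mpoly R[N + N]};
  sos_identity :
    -1 = sum_of_squares sos_free
         + \sum_(j : J) sum_of_squares (sos_ineq j) * q j
         + \sum_(j : I) sos_eq j * p j
         + (\sum_(i < N) sos_liftx i * (xvar R i ^+ 2 - xvar R i)
            + \sum_(i < N) sos_liftb i * (xbar R i ^+ 2 - xbar R i)
            + \sum_(i < N) sos_liftt i * (xvar R i + xbar R i - 1)) }.

(* The multipliers of the polynomials in B_N are not counted. *)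
Definition monomial_size (R : realFieldType) (N : nat) (J I : finType)
    (q : J -> {mpoly R[N + N]}) (p : I -> {mpoly R[N + N]})
    (pi : sos_refutation q p) : nat :=
  (\sum_(f <- sos_free pi) mon_size f
   + \sum_(j : J) \sum_(f <- sos_ineq pi j) mon_size f
   + \sum_(j : I) mon_size (sos_eq pi j))%N.

(* The variable x_e of an edge e is x_i, where i is the rank of e in the
   enumeration of the edge set. The equation f = -1 is the polynomial
   f - (-1). *)
Definition tseitin (R : realFieldType) (n : nat) (G : sgraph n) (u : 'I_n) :
    {mpoly R[#|edges G| + #|edges G|]} :=
  \prod_(i < #|edges G| | u \in enum_val i) (1 - 2 * xvar R i) - (-1).

Definition tseitin_ineq (R : realFieldType) (n : nat) (G : sgraph n)
    (j : void) : {mpoly R[#|edges G| + #|edges G|]} :=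
  match j with end.

Definition tseitin_sos_refutation (R : realFieldType) (n : nat)
    (G : sgraph n) : Type :=
  sos_refutation (@tseitin_ineq R n G) (@tseitin R n G).

(* Main.v *)
(* Write chi_A(x) = prod_{e in A} (-1)^(x_e).  The product of the constraints of
   a vertex set U says that chi on the edge cut bd U equals (-1)^|U|.

   Suppose that a refutation has fewer than 2^k terms.  A partial assignment rho
   on a set F of O(k) edges is built greedily: the most frequent literal of the
   monomials that are still nonzero and wide is set to 0.  An edge e is never
   chosen when it is forced, i.e. {e} = bd U \ F for some U with |U| <= n/2; this
   keeps rho consistent with the constraints of all such U.  Afterwards every
   surviving monomial has at most D = Omega(n) literals that are neither assigned
   nor forced.

   Substitute rho and the forced values, and let phi(T) be the value of chi_T
   that is implied by a vertex set U with |U| <= n/4 and bd U \ F = T, and 0 if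
   there is none.  By expansion a set T with few edges comes from a small U, so
   on such sets phi(T + T') (symmetric difference) is an equivalence relation
   with signs, hence positive semidefinite.  The linear functional
   chi_T |-> phi(T) is therefore nonnegative on the squares of the refutation,
   vanishes on the other summands, and is positive at 1, which contradicts the
   identity. *)
Require Import Defs.
From mathcomp Require Import all_boot all_order all_algebra.
From mathcomp Require Import mpoly.
From mathcomp Require Import reals exp.
From mathcomp Require Import zify.

Set Implicit Arguments.
Unset Strict Implicit.
Unset Printing Implicit Defensive.

Import Order.TTheory GRing.Theory Num.Theory.

Local Open Scope ring_scope.

(** * Symmetric differences and characters of the Boolean cube *)

Definition symdiff (T : finType) (A B : {set T}) : {set T} :=
  [set x | (x \in A) (+) (x \in B)].

Local Notation "A :+: B" := (symdiff A B) (at level 52, left associativity).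

Lemma symdiffA (T : finType) : associative (@symdiff T).
Proof. by move=> A B C; apply/setP=> x; rewrite !inE addbA. Qed.

Lemma symdiffC (T : finType) : commutative (@symdiff T).
Proof. by move=> A B; apply/setP=> x; rewrite !inE addbC. Qed.

Lemma symdiffK (T : finType) (B : {set T}) : involutive (fun A => A :+: B).
Proof. by move=> A; apply/setP=> x; rewrite !inE -addbA addbb addbF. Qed.

Lemma symdiffv (T : finType) (A : {set T}) : A :+: A = set0.
Proof. by apply/setP=> x; rewrite !inE addbb. Qed.

Lemma symdiff0 (T : finType) (A : {set T}) : A :+: set0 = A.
Proof. by apply/setP=> x; rewrite !inE addbF. Qed.

Lemma symdiffIl (T : finType) (A B C : {set T}) :
  (A :+: B) :&: C = (A :&: C) :+: (B :&: C).
Proof. by apply/setP=> x; rewrite !inE; do 3!case: (_ \in _). Qed.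

Lemma symdiffDl (T : finType) (A B C : {set T}) :
  (A :+: B) :\: C = (A :\: C) :+: (B :\: C).
Proof. by apply/setP=> x; rewrite !inE; do 3!case: (_ \in _). Qed.

Lemma card_symdiff (T : finType) (A B : {set T}) : (#|A :+: B| <= #|A| + #|B|)%N.
Proof.
apply: leq_trans (leq_card_setU A B); apply/subset_leq_card/subsetP=> x.
by rewrite !inE; do 2!case: (_ \in _).
Qed.

Definition chi (R : pzRingType) (T : finType) (A : {set T}) (x : T -> bool) : R :=
  \prod_(e in A) (-1) ^+ x e.
Arguments chi R {T} A x.

Section Characters.
Variables (R : comNzRingType) (T : finType).
Implicit Types (A B : {set T}) (x : T -> bool).

Lemma chi0 x : chi R set0 x = 1.
Proof. by rewrite /chi big_set0. Qed.

Lemma chi1 e x : chi R [set e] x = (-1) ^+ x e.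
Proof. by rewrite /chi big_set1. Qed.

Lemma chiM A B x : chi R (A :+: B) x = chi R A x * chi R B x.
Proof.
rewrite /chi [in LHS]big_mkcond [X in _ = X * _]big_mkcond [X in _ = _ * X]big_mkcond.
rewrite -big_split; apply: eq_bigr => e _; rewrite inE.
by case: (e \in A); case: (e \in B); rewrite /= ?mulr1 ?mul1r // -expr2 sqrr_sign.
Qed.

Lemma chi_setID A B x : chi R A x = chi R (A :&: B) x * chi R (A :\: B) x.
Proof.
rewrite -chiM; congr (chi _ _ _); apply/setP=> e; rewrite !inE.
by do 2!case: (_ \in _).
Qed.

Lemma eq_chi A x x' : {in A, x =1 x'} -> chi R A x = chi R A x'.
Proof. by move=> eqx; apply: eq_bigr => e /eqx ->. Qed.

Lemma chi_sqr A x : chi R A x * chi R A x = 1.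
Proof. by rewrite -chiM symdiffv chi0. Qed.

Lemma chi_sign A x : {b : bool | chi R A x = (-1) ^+ b}.
Proof.
rewrite /chi; elim/big_rec: _ => [|e s _ [b ->]]; first by exists false.
by exists (x e (+) b); rewrite signr_addb.
Qed.

End Characters.

(** * Fourier analysis on the Boolean cube *)

Definition flip (T : finType) (e : T) (x : {ffun T -> bool}) : {ffun T -> bool} :=
  [ffun f => x f (+) (f == e)].

Lemma flipK (T : finType) (e : T) : involutive (flip e).
Proof. by move=> x; apply/ffunP=> f; rewrite !ffunE -addbA addbb addbF. Qed.

Lemma chi_flip (R : comNzRingType) (T : finType) (e : T) (A : {set T}) (x : {ffun T -> bool}) :
  e \in A -> chi R A (flip e x) = - chi R A x.
Proof.
move=> eA; rewrite /chi (bigD1 e) //= [in RHS](bigD1 e) //= -mulNr; congr (_ * _).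
  by rewrite ffunE eqxx addbT signrN.
by apply: eq_bigr => f /andP[_ fe]; rewrite ffunE (negPf fe) addbF.
Qed.

(** Unnormalized: the factor [#|{set T}|] reappears in [fourier_inversion]. *)
Definition fhat (R : pzRingType) (T : finType) (g : {ffun T -> bool} -> R) (A : {set T}) : R :=
  \sum_x g x * chi R A x.

Definition lowdeg (R : pzRingType) (T : finType) (D : nat) (g : {ffun T -> bool} -> R) : Prop :=
  forall A : {set T}, (D < #|A|)%N -> fhat g A = 0.

Section Fourier.
Variables (R : realFieldType) (T : finType).
Implicit Types (A B : {set T}) (g : {ffun T -> bool} -> R) (x : {ffun T -> bool}).

Lemma eqN_eq0 (r : R) : r = - r -> r = 0.
Proof.
move=> rN; apply/eqP; have: r *+ 2 == 0 by rewrite mulr2n {2}rN subrr.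
by rewrite mulrn_eq0.
Qed.

Lemma chi_sum0 A : A != set0 -> \sum_(x : {ffun T -> bool}) chi R A x = 0.
Proof.
case/set0Pn=> e eA; apply: eqN_eq0.
rewrite [LHS](reindex_inj (inv_inj (flipK e))) /= -sumrN.
by apply: eq_bigr => x _; rewrite chi_flip.
Qed.

(** Toggling in [A] an element at which [x] and [x'] differ negates the summand. *)
Lemma chi_orth x x' : x != x' -> \sum_A chi R A x * chi R A x' = 0.
Proof.
case/eqP/ffunP/eqfunP/forallPn=> e nex; apply: eqN_eq0.
rewrite [LHS](reindex_inj (inv_inj (symdiffK [set e]))) /= -sumrN.
apply: eq_bigr => A _; rewrite !chiM !chi1 mulrACA.
have -> : (-1) ^+ x e * (-1) ^+ x' e = -1 :> R.
  by rewrite -signr_addb; move: nex; case: (x e); case: (x' e).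
by rewrite mulrN1.
Qed.

Lemma fourier_inversion g x :
  \sum_A fhat g A * chi R A x = #|{set T}|%:R * g x.
Proof.
under eq_bigr do rewrite mulr_suml.
rewrite exchange_big /= (bigD1 x) //= [X in _ + X]big1 ?addr0.
  under eq_bigr do rewrite -mulrA chi_sqr mulr1.
  by rewrite sumr_const mulr_natl.
move=> x' nx; under eq_bigr do rewrite -mulrA.
by rewrite -mulr_sumr chi_orth ?mulr0.
Qed.

Lemma lowdeg_sum D (I : eqType) (s : seq I) (c : I -> R) (g : I -> {ffun T -> bool} -> R) :
  {in s, forall i, lowdeg D (g i)} -> lowdeg D (fun x => \sum_(i <- s) c i * g i x).
Proof.
move=> lowg A DA; rewrite /fhat.
under eq_bigr do rewrite mulr_suml.
rewrite exchange_big /= big_seq big1 // => i si.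
under eq_bigr do rewrite -mulrA.
by rewrite -mulr_sumr -/(fhat (g i) A) lowg ?mulr0.
Qed.

(** A set [B] with more than [D] elements has some [e] outside [A]. Flipping [e] preserves [g] and
    negates the character of [B], so the coefficient is its own negative. *)
Lemma lowdeg_junta D A g :
  (forall x x', {in A, x =1 x'} -> g x = g x') -> (#|A| <= D)%N -> lowdeg D g.
Proof.
move=> gA AD B DB.
have /subsetPn[e eB neA] : ~~ (B \subset A).
  by apply: contraTN DB => /subset_leq_card BA; rewrite -leqNgt (leq_trans BA).
apply: eqN_eq0; rewrite /fhat [LHS](reindex_inj (inv_inj (flipK e))) /= -sumrN.
apply: eq_bigr => x _; rewrite chi_flip // mulrN (gA _ x) // => f fA.
by rewrite ffunE (negPf (memPn neA _ fA)) addbF.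
Qed.

End Fourier.

(* [M] is the signed indicator of an equivalence relation; dividing by the size
   [w] of the classes makes it a Gram matrix, [M i k = sum_j M i j M j k / w j]. *)
Lemma psd_signed_equivalence (R : realFieldType) (I : finType) (Q : pred I)
    (M : I -> I -> R) (c : I -> R) :
  (forall i, Q i -> M i i = 1) -> (forall i j, M i j = M j i) ->
  (forall i j k, Q i -> Q j -> Q k ->
     M i j != 0 -> M j k != 0 -> M i k = M i j * M j k) ->
  0 <= \sum_(i | Q i) \sum_(j | Q j) c i * c j * M i j.
Proof.
move=> M1 Msym Mtr.
pose w j := #|[pred k | Q k && (M j k != 0)]|.
have Msq i k : Q i -> Q k ->
    M i k = \sum_(j | Q j) (w j)%:R^-1 * (M i j * M j k).
  move=> Qi Qk; have [Mik0|Mik] := eqVneq (M i k) 0.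
    rewrite Mik0 big1 // => j Qj.
    have [->|Mij] := eqVneq (M i j) 0; first by rewrite mul0r mulr0.
    have [->|Mjk] := eqVneq (M j k) 0; first by rewrite !mulr0.
    by rewrite -Mtr // Mik0 mulr0.
  (* Only the [j] in the class of [i] contribute. There are [w i] of them, all with [w j = w i]. *)
  rewrite (bigID (fun j => M i j != 0)) /= [X in _ + X]big1 ?addr0; last first.
    by move=> j /andP[_]; rewrite negbK => /eqP ->; rewrite mul0r mulr0.
  transitivity (\sum_(j | Q j && (M i j != 0)) (w i)%:R^-1 * M i k).
    rewrite sumr_const -/(w i) -mulrnAl -[_ *+ w i]mulr_natl mulfV ?mul1r //.
    rewrite pnatr_eq0 -lt0n; apply/card_gt0P; exists i.
    by rewrite inE Qi M1 ?oner_eq0.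
  apply: eq_bigr => j /andP[Qj Mij].
  have Mjk : M j k = M j i * M i k by rewrite -Mtr // Msym.
  have Mjk0 : M j k != 0 by rewrite Mjk mulf_neq0 // Msym.
  rewrite -Mtr //; congr (_%:R^-1 * _); apply: eq_card => l; rewrite !inE.
  case Ql: (Q l) => //=; apply/idP/idP => H.
    by rewrite (Mtr j i l) // ?mulf_neq0 // Msym.
  by rewrite (Mtr i j l) // mulf_neq0.
have -> : \sum_(i | Q i) \sum_(j | Q j) c i * c j * M i j
        = \sum_(l | Q l) (w l)%:R^-1 * (\sum_(i | Q i) c i * M i l) ^+ 2.
  transitivity (\sum_(i | Q i) \sum_(j | Q j) \sum_(l | Q l)
     (w l)%:R^-1 * ((c i * M i l) * (c j * M j l))).
    apply: eq_bigr => i Qi; apply: eq_bigr => j Qj.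
    rewrite (Msq i j) // mulr_sumr; apply: eq_bigr => l Ql.
    by rewrite mulrCA (Msym l j) mulrACA.
  transitivity (\sum_(i | Q i) \sum_(l | Q l) \sum_(j | Q j)
     (w l)%:R^-1 * ((c i * M i l) * (c j * M j l))).
    by apply: eq_bigr => i Qi; rewrite exchange_big.
  rewrite exchange_big; apply: eq_bigr => l Ql; rewrite expr2 mulr_suml mulr_sumr.
  by apply: eq_bigr => i Qi; rewrite !mulr_sumr.
by apply: sumr_ge0 => l _; rewrite mulr_ge0 ?invr_ge0 ?ler0n ?sqr_ge0.
Qed.

(** * Restrictions *)

Section Restrictions.
Variables (R : realFieldType) (V E : finType) (bd : {set V} -> {set E}).
Hypothesis bdD : {morph bd : A B / A :+: B}.
Implicit Types (U W : {set V}) (F A B T : {set E}) (rho : {ffun E -> bool}).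

(* The constraints of [U] restricted by [rho] imply
   [chi (bd U :\: F) x = sgn F rho U]. *)
Definition sgn F rho U : R := chi R U xpredT * chi R (bd U :&: F) rho.

Definition consistent F rho : Prop :=
  forall U, (2 * #|U| <= #|V|)%N -> bd U \subset F -> sgn F rho U = 1.

Definition forced F e : bool :=
  [exists U : {set V}, (2 * #|U| <= #|V|)%N && (bd U :\: F == [set e])].

Definition free F e : bool := (e \notin F) && ~~ forced F e.

Definition update rho e b : {ffun E -> bool} :=
  [ffun f => if f == e then b else rho f].

Lemma sgnM F rho U W : sgn F rho (U :+: W) = sgn F rho U * sgn F rho W.
Proof. by rewrite /sgn chiM bdD symdiffIl chiM mulrACA. Qed.

Lemma sgn_sqr F rho U : sgn F rho U * sgn F rho U = 1.
Proof. by rewrite /sgn mulrACA !chi_sqr mulr1. Qed.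

Lemma bd0 : bd set0 = set0.
Proof. by rewrite -(symdiffv set0) bdD symdiffv. Qed.

Lemma forced_notin F e : forced F e -> e \notin F.
Proof.
case/existsP=> U /andP[_ /eqP UF].
by have : e \in bd U :\: F by [rewrite UF set11]; rewrite inE => /andP[].
Qed.

(** A cut that forces [e] over [F] still forces it over [F'] as long as [e] is not in [F']. *)
Lemma free_sub F F' e : F \subset F' -> free F' e -> free F e.
Proof.
move=> sFF' /andP[eF' nfo]; have eF : e \notin F by apply: contra eF' => /(subsetP sFF').
rewrite /free eF; apply: contra nfo => /existsP[U /andP[sU /eqP UF]].
apply/existsP; exists U; rewrite sU; apply/eqP/setP=> f; rewrite inE.
have := congr1 (fun A => f \in A) UF; rewrite !inE => <-.
have [fF|fF] /= := boolP (f \in F); first by rewrite (subsetP sFF') .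
case fU: (f \in bd U); rewrite ?andbF // andbT.
have : f \in bd U :\: F by rewrite inE fF.
by rewrite UF inE => /eqP ->.
Qed.

(** A small cut inside [e |: F] that contained [e] would force [e]. So each such cut already lies in
    [F], and its sign does not see the new value. *)
Lemma consistent_update F rho e b :
  consistent F rho -> free F e -> consistent (e |: F) (update rho e b).
Proof.
move=> cF /andP[eF nfo] U sU UF.
have eU : e \notin bd U.
  apply: contra nfo => eU; apply/existsP; exists U; rewrite sU.
  apply/eqP/setP=> f; rewrite !inE.
  have [->|fe] := eqVneq f e; first by rewrite eF eU.
  by have := subsetP UF f; rewrite !inE (negPf fe) /=; do 2![case: (f \in _)] => // /(_ isT).
have UF' : bd U \subset F.
  apply/subsetP=> f fU; have := subsetP UF f fU; rewrite !inE.
  by rewrite (negPf (memPn eU _ fU)).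
rewrite -(cF U sU UF') /sgn; congr (_ * _).
rewrite (setIidPl UF) (setIidPl UF'); apply: eq_chi => f fU.
by rewrite ffunE (negPf (memPn eU _ fU)).
Qed.

(* A monomial is represented by its set of literals, where [(e, b)] is the
   literal that takes the value 1 exactly when [x_e = b]. *)
Definition killed F rho (m : {set E * bool}) : bool :=
  [exists l in m, (l.1 \in F) && (rho l.1 != l.2)].

Definition wide D F (m : {set E * bool}) : bool :=
  (D < #|[set l in m | free F l.1]|)%N.

Definition bad D F rho m := ~~ killed F rho m && wide D F m.

(** Falsifying the literal [(e, b)] kills every monomial that contains it, and enlarging [F] never
    makes a monomial bad. *)
Lemma bad_update D F rho e b m :
  e \notin F -> bad D (e |: F) (update rho e (~~ b)) m ->
  bad D F rho m && ((e, b) \notin m).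
Proof.
move=> eF /andP[alive wm]; apply/andP; split; first (apply/andP; split).
- apply: contra alive => /existsP[l /andP[lm /andP[lF rl]]].
  apply/existsP; exists l; rewrite lm !inE lF orbT ffunE /=.
  by rewrite (negPf (memPn eF _ lF)).
- apply: leq_trans wm _; apply/subset_leq_card/subsetP=> l; rewrite !inE.
  case/andP=> -> /(@free_sub F) -> //; exact: subsetUr.
- apply: contra alive => lm; apply/existsP; exists (e, b).
  by rewrite lm !inE eqxx ffunE eqxx; case: (b).
Qed.

(** Averaging: each bad monomial has more than [D] of the [2 * #|E|] literals free, so some free
    literal occurs in at least a fraction [1/c] of the bad monomials. *)
Lemma frequent_literal D c F rho (ms : seq {set E * bool}) :
  (2 * #|E| <= c * D)%N -> (0 < count (bad D F rho) ms)%N ->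
  exists2 l, free F l.1 &
    (count (bad D F rho) ms
      <= c * count (fun m => bad D F rho m && (l \in m)) ms)%N.
Proof.
set k := count _ ms => cD k0.
have [l /andP[fl kl]|none] := pickP (fun l : E * bool => free F l.1 &&
  (k <= c * count (fun m => bad D F rho m && (l \in m)) ms)%N); first by exists l.
suff : (c * D * k < c * D * k)%N by rewrite ltnn.
(* For [c = 0] there are no edges, hence no wide monomials. *)
have c_gt0 : (0 < c)%N.
  rewrite lt0n; apply: contraL k0 => /eqP c0.
  rewrite -leqNgt leqNgt -has_count; apply/hasPn=> m _.
  rewrite /bad negb_and /wide -leqNgt (leq_trans (max_card _)) ?orbT //.
  by rewrite card_prod card_bool mulnC (leq_trans cD) // c0.
apply: (@leq_trans (c * D.+1 * k)%N); first by rewrite ltn_pmul2r // ltn_pmul2l.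
apply: leq_trans (_ : 2 * #|E| * k <= _)%N; last by rewrite leq_mul2r cD orbT.
have -> : (2 * #|E| * k = \sum_(l : E * bool) k)%N.
  by rewrite sum_nat_const card_prod card_bool [(2 * _)%N]mulnC.
apply: (@leq_trans (\sum_(l : E * bool | free F l.1)
   c * count (fun m => bad D F rho m && (l \in m)) ms)%N); last first.
  rewrite [leqRHS](bigID (fun l : E * bool => free F l.1)) /=.
  apply: leq_trans (leq_addr _ _); apply: leq_sum => l fl.
  by have := none l; rewrite fl /= => /negbT; rewrite -ltnNge => /ltnW.
rewrite -big_distrr /= -mulnA leq_mul2l; apply/orP; right.
have -> : (\sum_(l : E * bool | free F l.1) count (fun m => bad D F rho m && (l \in m)) ms
  = \sum_(m <- ms) \sum_(l : E * bool | free F l.1) (bad D F rho m && (l \in m)))%N.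
  by rewrite exchange_big; apply: eq_bigr => l _; rewrite -sum1_count big_mkcond.
have -> : (k = \sum_(m <- ms) bad D F rho m)%N by rewrite /k -sum1_count big_mkcond.
rewrite big_distrr /=; apply: leq_sum => m _.
case bm: (bad D F rho m); last by rewrite muln0.
rewrite muln1; case/andP: bm => _ /leq_trans -> //.
rewrite -sum1_card big_mkcond [leqRHS]big_mkcond; apply: leq_sum => l _.
by rewrite !inE andbC; case: (free _ _); case: (l \in m).
Qed.

(** Each round falsifies a frequent literal and multiplies the number of bad monomials by at most
    [1 - 1/c]; the bound is stated without division. *)
Lemma greedy_restriction D c (ms : seq {set E * bool}) i :
  consistent set0 [ffun=> false] -> (2 * #|E| <= c * D)%N -> (0 < c)%N ->
  exists F rho, [/\ (#|F| <= i)%N, consistent F rho &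
    (c ^ i * count (bad D F rho) ms <= c.-1 ^ i * size ms)%N].
Proof.
move=> c0 cD c_gt0; elim: i => [|i [F [rho [Fi cF cnt]]]].
  exists set0, [ffun=> false]; split; rewrite ?cards0 //.
  by rewrite !expn0 !mul1n count_size.
(* With no bad monomial left the process stops early, which is why [F] has at most [i] elements. *)
have [k0|k0] := posnP (count (bad D F rho) ms).
  by exists F, rho; split; rewrite ?k0 ?muln0 // (leq_trans Fi).
have [[e b] /= fe cl] := frequent_literal cD k0.
have eF : e \notin F by case/andP: fe.
exists (e |: F), (update rho e (~~ b)); split; first by rewrite cardsU1 eF.
  exact: consistent_update.
apply: (@leq_trans (c ^ i * (c.-1 * count (bad D F rho) ms))%N); last first.
  by rewrite mulnCA expnS -mulnA leq_mul2l cnt orbT.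
rewrite expnSr -mulnA leq_mul2l; apply/orP; right.
have /sub_count/(_ ms) : subpred (bad D (e |: F) (update rho e (~~ b)))
    (fun m => bad D F rho m && ((e, b) \notin m)) by move=> m; exact: bad_update.
have := count_predC (fun m : {set E * bool} => (e, b) \in m) [seq m <- ms | bad D F rho m].
rewrite size_filter !count_filter.
set p := count _ _; set q := count _ _; set r := count _ _.
have -> : count (fun m => bad D F rho m && ((e, b) \notin m)) ms = q.
  by apply: eq_count => m /=; rewrite andbC.
have : p = count (fun m => bad D F rho m && ((e, b) \in m)) ms.
  by apply: eq_count => m /=; rewrite andbC.
move=> pE; rewrite -pE in cl; move: cl; rewrite -/r.
move: (count _ _) => z; move: p q r {pE} c_gt0 => p q r; clear.
case: c => // c _ /=; nia.
Qed.

Lemma double_predn_exp c : (0 < c)%N -> (2 * c.-1 ^ c <= c ^ c)%N.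
Proof.
case: c => // c _ /=.
(* Bernoulli's inequality [1 + m/c <= (1 + 1/c)^m], to be used at [m = c + 1]. *)
suff H m : (c ^ m * (c + m) <= c * c.+1 ^ m)%N.
  have [->|c_gt0] := posnP c; first by rewrite exp0n.
  by rewrite -(leq_pmul2l c_gt0) (leq_trans _ (H _)) //; nia.
elim: m => [|m IH]; first by rewrite !expn0 mul1n muln1 addn0.
rewrite !expnS; nia.
Qed.

(** Every [c] rounds at least halve the number of bad monomials, so after [c * k] rounds fewer than
    one is left. *)
Lemma narrow_restriction D c k (ms : seq {set E * bool}) :
  consistent set0 [ffun=> false] -> (2 * #|E| <= c * D)%N -> (0 < c)%N ->
  (size ms < 2 ^ k)%N ->
  exists F rho, [/\ (#|F| <= c * k)%N, consistent F rho & ~~ has (bad D F rho) ms].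
Proof.
move=> c0 cD c_gt0 szms.
have [F [rho [Fi cF cnt]]] := greedy_restriction ms (c * k) c0 cD c_gt0.
exists F, rho; split=> //; rewrite has_count -leqNgt leqNgt; apply/negP=> k0.
have ck : (c.-1 ^ (c * k) * 2 ^ k <= c ^ (c * k))%N.
  rewrite !expnM -expnMn.
  case: (k) => [|k']; first by rewrite !expn0.
  by rewrite leq_exp2r // mulnC double_predn_exp.
(* If the power vanishes, [cnt] itself leaves no bad monomial; otherwise multiplying by it preserves
   the strict inequality. *)
have [c1|c1] := posnP (c.-1 ^ (c * k)).
  have : (0 < c ^ (c * k))%N by rewrite expn_gt0 c_gt0.
  by move: cnt; rewrite c1 mul0n; nia.
have : (c.-1 ^ (c * k) * size ms < c.-1 ^ (c * k) * 2 ^ k)%N by rewrite ltn_pmul2l.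
by nia.
Qed.

(** * Values of the forced edges *)

Variables (a t : nat) (F : {set E}) (rho : {ffun E -> bool}).
Hypothesis expanding : forall U, (2 * #|U| <= #|V|)%N -> (#|U| <= a * #|bd U|)%N.
Hypothesis card_F : (#|F| <= t)%N.
Hypothesis consistentF : consistent F rho.

(** By expansion only the empty vertex set has an empty cut. *)
Lemma consistent0 rho0 : consistent set0 rho0.
Proof.
move=> U /expanding leU; rewrite subset0 => /eqP U0; move: leU.
rewrite U0 cards0 muln0 leqn0 cards_eq0 => /eqP ->.
by rewrite /sgn bd0 set0I !chi0 mulr1.
Qed.

(** At most [t] edges of the cut lie in [F], so the whole cut has at most [w + t] edges and
    expansion bounds [U]. *)
Lemma card_small_cut w U :
  (2 * #|U| <= #|V|)%N -> (#|bd U :\: F| <= w)%N -> (#|U| <= a * (w + t))%N.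
Proof.
move=> /expanding leU wU; apply: leq_trans leU _; rewrite leq_mul2l; apply/orP; right.
by rewrite -(cardsID F) addnC leq_add // (leq_trans _ card_F) // subset_leq_card ?subsetIr.
Qed.

(** The default [set0] has sign 1, so [extension] is false on the free edges. *)
Definition forcing_cut e : {set V} :=
  odflt set0 [pick U : {set V} | (2 * #|U| <= #|V|)%N && (bd U :\: F == [set e])].

Lemma forcing_cutP e : forced F e ->
  (2 * #|forcing_cut e| <= #|V|)%N /\ bd (forcing_cut e) :\: F = [set e].
Proof.
case/existsP=> U HU; rewrite /forcing_cut.
by case: pickP => [W /andP[-> /eqP]|/(_ U)]; last rewrite HU.
Qed.

Definition extension : {ffun E -> bool} :=
  [ffun e => if e \in F then rho e else sgn F rho (forcing_cut e) == -1].

Local Notation tau := extension.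

Lemma sgn_extension e : e \notin F -> (-1) ^+ tau e = sgn F rho (forcing_cut e).
Proof.
move=> eF; rewrite ffunE (negPf eF) /sgn.
have [b ->] := chi_sign R (forcing_cut e) xpredT.
have [b' ->] := chi_sign R (bd (forcing_cut e) :&: F) rho.
by rewrite -signr_addb; case: (b (+) b'); rewrite /= ?eqxx // (gt_eqF (lt_trans (ltrN10 R) ltr01)).
Qed.

(** [W] is the symmetric difference of the forcing cuts of the edges of [A], each of size at most
    [a * (1 + t)] by [card_small_cut]. *)
Lemma forced_cut A : (forall e, e \in A -> forced F e) ->
  exists W, [/\ bd W :\: F = A, sgn F rho W = chi R A tau &
    (#|W| <= #|A| * (a * (1 + t)))%N].
Proof.
move: {-1}#|A| (erefl #|A|) => n; elim: n A => [|n IH] A cA foA.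
  have A0 : A = set0 by apply/eqP; rewrite -cards_eq0 cA.
  exists set0; split; rewrite ?cards0 // A0 ?bd0 ?set0D //.
  by rewrite /sgn bd0 set0I !chi0 mulr1.
have [e eA] : exists e, e \in A by apply/set0Pn; rewrite -cards_eq0 cA.
have AE : A = [set e] :+: (A :\ e).
  by apply/setP=> f; rewrite !inE; case: eqP => // ->.
have cA' : #|A :\ e| = n by move: cA; rewrite (cardsD1 e) eA => -[].
have [|W [WA sW cW]] := IH _ cA'; first by move=> f; rewrite inE => /andP[_ /foA].
have foe := foA _ eA; have [sC bC] := forcing_cutP foe.
exists (forcing_cut e :+: W); split.
- by rewrite bdD symdiffDl bC WA -AE.
- by rewrite sgnM sW -sgn_extension ?(forced_notin foe) // [in RHS]AE chiM chi1.
- rewrite (leq_trans (card_symdiff _ _)) // mulSn leq_add // -?cA' //.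
  by rewrite card_small_cut // bC cards1.
Qed.

Definition assigned : {set E} := [set e | ~~ free F e].

(* Absorbing the forced edges at [u] into the cut: the restricted constraint of
   [u] has the form of a cut [bd W :\: F] with [W] still small. *)
Lemma vertex_cut d u : (#|bd [set u]| <= d)%N ->
  exists W, [/\ bd W :\: F = bd [set u] :\: assigned,
    sgn F rho W = - chi R (bd [set u] :&: assigned) tau &
    (#|W| <= 1 + d * (a * (1 + t)))%N].
Proof.
(* Adding to [u] the set [W] obtained for its forced edges cancels exactly these edges from the cut.
   The minus sign is the parity of the single vertex [u]. *)
move=> du; pose A := [set e in bd [set u] | forced F e].
have [|W [WA sW cW]] := @forced_cut A; first by move=> e; rewrite inE => /andP[].
have fF e : e \in F -> forced F e = false.
  by move=> eF; apply: contraTF eF => /forced_notin.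
exists ([set u] :+: W); split.
- rewrite bdD symdiffDl WA; apply/setP=> e; rewrite !inE /free negbK.
  have := fF e; case: (e \in F) => /= [->//|_]; rewrite ?andbF //.
  by case: (e \in bd _); case: (forced F e).
- have -> : bd [set u] :&: assigned = (bd [set u] :&: F) :+: A.
    apply/setP=> e; rewrite !inE /free negb_and !negbK.
    have := fF e; case: (e \in F) => /= [->//|_]; rewrite ?andbF ?addbF //.
  rewrite sgnM sW chiM /sgn chi1 expr1 !mulN1r mulNr; congr (- (_ * _)).
  by apply: eq_chi => e; rewrite inE ffunE => /andP[_ ->].
- rewrite (leq_trans (card_symdiff _ _)) // cards1 leq_add2l (leq_trans cW) //.
  rewrite leq_mul2r (leq_trans _ du) ?orbT // subset_leq_card //.
  by apply/subsetP=> e; rewrite inE => /andP[].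
Qed.

(** * The pseudo-expectation *)

(** A quarter of the vertices, so that the symmetric difference of two such sets stays within the
    half covered by [consistent]. *)
Definition phi T : R :=
  if [pick U : {set V} | (4 * #|U| <= #|V|)%N && (bd U :\: F == T)] is Some U
  then sgn F rho U else 0.

(** The value is independent of the representative: if [U] and [W] leave the same edges outside [F],
    the cut of [U :+: W] lies inside [F] and has sign 1. *)
Lemma phi_cut U : (4 * #|U| <= #|V|)%N -> phi (bd U :\: F) = sgn F rho U.
Proof.
move=> sU; rewrite /phi; case: pickP => [W /andP[sW /eqP bdW]|/(_ U)]; last first.
  by rewrite sU eqxx.
have UW1 : sgn F rho (U :+: W) = 1.
  apply: consistentF; first by move: (card_symdiff U W) sU sW; clear; lia.
  rewrite -setD_eq0 bdD symdiffDl bdW symdiffv eqxx //.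
by rewrite -[LHS]mul1r -UW1 sgnM -mulrA sgn_sqr mulr1.
Qed.

Lemma phi_supp T : phi T != 0 ->
  exists2 U : {set V}, (4 * #|U| <= #|V|)%N & bd U :\: F = T.
Proof.
rewrite /phi; case: pickP => [W /andP[sW /eqP bdW] _|]; last by rewrite eqxx.
by exists W.
Qed.

Lemma phi_supp_small w T : phi T != 0 -> (#|T| <= w)%N ->
  exists2 U : {set V}, (#|U| <= a * (w + t))%N /\ (4 * #|U| <= #|V|)%N & bd U :\: F = T.
Proof.
case/phi_supp=> U sU UT wT; exists U => //; split=> //.
by apply: card_small_cut; rewrite ?UT //; lia.
Qed.

(** A representative of a small [T] has at most [a * (w + t)] vertices, so adding [W] to it keeps it
    below a quarter. *)
Lemma phi_translate w W T : (4 * (#|W| + a * (w + t)) <= #|V|)%N ->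
  (#|T| <= w)%N -> phi T != 0 -> phi (T :+: (bd W :\: F)) = phi T * sgn F rho W.
Proof.
move=> sW wT /phi_supp_small/(_ wT)[U [cU sU] UT].
rewrite -{}UT -symdiffDl -bdD !phi_cut ?sgnM //.
by have := card_symdiff U W; lia.
Qed.

(** Translation by [W] is an involution, so [phi] vanishes at both ends or at neither. *)
Lemma phi_translate_iff w W T : (4 * (#|W| + a * (w + t)) <= #|V|)%N ->
  (#|T| <= w)%N -> (#|T :+: (bd W :\: F)| <= w)%N ->
  phi (T :+: (bd W :\: F)) = phi T * sgn F rho W.
Proof.
move=> sW wT wTW; have [T0|] := eqVneq (phi T) 0; last exact: phi_translate sW wT.
rewrite T0 mul0r; apply/eqP; apply: contraT => nz.
have := phi_translate sW wTW nz; rewrite symdiffK T0 => /esym/eqP.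
rewrite mulf_eq0 (negPf nz) /= => /eqP s0.
by have := sgn_sqr F rho W; rewrite s0 mul0r => /esym/eqP; rewrite oner_eq0.
Qed.

Lemma phiM w T T' : (8 * (a * (w + t)) <= #|V|)%N -> (#|T| <= w)%N -> (#|T'| <= w)%N ->
  phi T != 0 -> phi T' != 0 -> phi (T :+: T') = phi T * phi T'.
Proof.
move=> sw wT wT' nT /phi_supp_small/(_ wT')[U [cU sU] <-].
by rewrite (phi_translate (w := w)) ?phi_cut //; lia.
Qed.

Lemma phi_set0 : phi set0 = 1.
Proof.
have := @phi_cut set0; rewrite cards0 bd0 set0D => -> //.
by rewrite /sgn bd0 set0I !chi0 mulr1.
Qed.

(* Not normalized: [pseudo (chi T)] is [2^#|E| * phi T]. *)
Definition pseudo (g : {ffun E -> bool} -> R) : R :=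
  \sum_x g x * \sum_T phi T * chi R T x.

Lemma eq_pseudo g h : g =1 h -> pseudo g = pseudo h.
Proof. by move=> gh; apply: eq_bigr => x _; rewrite gh. Qed.

Lemma pseudoD g h : pseudo (fun x => g x + h x) = pseudo g + pseudo h.
Proof. by rewrite /pseudo -big_split; apply: eq_bigr => x _; rewrite mulrDl. Qed.

Lemma pseudo_sum (I : Type) (s : seq I) (Q : pred I) (c : I -> R)
    (g : I -> {ffun E -> bool} -> R) :
  pseudo (fun x => \sum_(i <- s | Q i) c i * g i x) = \sum_(i <- s | Q i) c i * pseudo (g i).
Proof.
rewrite /pseudo; under eq_bigr do rewrite mulr_suml.
rewrite exchange_big /=; apply: eq_bigr => i _; rewrite mulr_sumr.
by apply: eq_bigr => x _; rewrite mulrA.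
Qed.

Lemma pseudo_chi T : pseudo (chi R T) = #|{ffun E -> bool}|%:R * phi T.
Proof.
rewrite /pseudo; under eq_bigr do rewrite mulr_sumr.
rewrite exchange_big /= (bigD1 T) //= [X in _ + X]big1 ?addr0.
  under eq_bigr do rewrite mulrCA chi_sqr mulr1.
  by rewrite sumr_const mulr_natl.
move=> T' nT; under eq_bigr do rewrite mulrCA -chiM.
rewrite -mulr_sumr chi_sum0 ?mulr0 //; apply: contra nT => /eqP TT'.
by rewrite -(symdiffK T' T) TT' symdiffC symdiff0.
Qed.

Lemma fourier_lowdeg D (g : {ffun E -> bool} -> R) x : lowdeg D g ->
  #|{set E}|%:R * g x = \sum_(A : {set E} | (#|A| <= D)%N) fhat g A * chi R A x.
Proof.
move=> lowg; rewrite -fourier_inversion [RHS]big_mkcond; apply: eq_bigr => A _.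
by case: leqP => // /lowg ->; rewrite mul0r.
Qed.

(** Expanding [g] in characters gives a quadratic form with matrix [phi (A :+: B)]. The [2 * D]
    bounds the size of [A :+: B]. *)
Lemma pseudo_sqr_ge0 D g : (8 * (a * (2 * D + t)) <= #|V|)%N -> lowdeg D g ->
  0 <= pseudo (fun x => g x ^+ 2).
Proof.
move=> sD lowg; have K_gt0 : 0 < #|{set E}|%:R :> R.
  by rewrite ltr0n; apply/card_gt0P; exists set0.
rewrite -(pmulr_rge0 _ (mulr_gt0 K_gt0 K_gt0)).
have -> : #|{set E}|%:R * #|{set E}|%:R * pseudo (fun x => g x ^+ 2)
    = #|{ffun E -> bool}|%:R * \sum_(A : {set E} | (#|A| <= D)%N) \sum_(B : {set E} | (#|B| <= D)%N)
        fhat g A * fhat g B * phi (A :+: B).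
  transitivity (pseudo (fun x => \sum_(A : {set E} | (#|A| <= D)%N) fhat g A *
      \sum_(B : {set E} | (#|B| <= D)%N) fhat g B * chi R (A :+: B) x)).
    rewrite /pseudo mulr_sumr; apply: eq_bigr => x _.
    rewrite mulrA expr2 mulrACA (fourier_lowdeg x lowg) mulr_suml; congr (_ * _).
    apply: eq_bigr => A _; rewrite -mulrA mulr_sumr; congr (_ * _).
    by apply: eq_bigr => B _; rewrite chiM mulrCA.
  rewrite pseudo_sum mulr_sumr; apply: eq_bigr => A _.
  rewrite pseudo_sum !mulr_sumr; apply: eq_bigr => B _.
  by rewrite pseudo_chi mulrA mulrCA.
rewrite mulr_ge0 ?ler0n //.
apply: (psd_signed_equivalence (M := fun A B => phi (A :+: B)) (fhat g)) => [A _|A B|A B C].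
- by rewrite symdiffv phi_set0.
- by rewrite symdiffC.
move=> DA DB DC AB BC.
have -> : A :+: C = (A :+: B) :+: (B :+: C).
  by rewrite symdiffA symdiffK.
by apply: (phiM sD) => //; apply: leq_trans (card_symdiff _ _) _; lia.
Qed.

Lemma pseudo_vertex d D g u : (#|bd [set u]| <= d)%N ->
  (4 * (1 + d * (a * (1 + t)) + a * (D + d + t)) <= #|V|)%N -> lowdeg D g ->
  pseudo (fun x => g x * (chi R (bd [set u] :&: assigned) tau *
                          chi R (bd [set u] :\: assigned) x + 1)) = 0.
Proof.
move=> du sD lowg; set s := chi R _ tau; set B := bd _ :\: assigned.
have [W [WB sW cW]] := vertex_cut du.
apply/eqP; have K_gt0 : #|{set E}|%:R != 0 :> R.
  by rewrite pnatr_eq0 -lt0n; apply/card_gt0P; exists set0.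
rewrite -(mulrI_eq0 _ (mulfI K_gt0)).
(* The sum over [bool] packs the two terms of the constraint so that [pseudo_sum] applies; they
   cancel for each [A] by translation along [W]. *)
have -> : #|{set E}|%:R * pseudo (fun x => g x * (s * chi R B x + 1)) =
  pseudo (fun x => \sum_(A : {set E} | (#|A| <= D)%N) fhat g A *
    \sum_(b : bool) (if b then s else 1) * chi R (if b then A :+: B else A) x).
  rewrite /pseudo mulr_sumr; apply: eq_bigr => x _.
  rewrite !mulrA (fourier_lowdeg x lowg); congr (_ * _).
  rewrite mulr_suml; apply: eq_bigr => A _.
  rewrite big_bool /= -mulrA chiM mulrDr mulr1 mul1r; congr (_ * (_ + _)).
  by rewrite mulrCA.
rewrite pseudo_sum big1 // => A DA.
rewrite pseudo_sum big_bool /= !pseudo_chi mul1r.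
have DB : (#|B| <= d)%N by rewrite (leq_trans _ du) // subset_leq_card ?subsetDl.
have := @phi_translate_iff (D + d) W A; rewrite WB -/B sW -/s => -> //.
- by rewrite mulrN mulrN mulrN mulrCA (mulrC (phi A)) (mulrA s s) chi_sqr mul1r addNr mulr0.
- by apply: leq_trans sD; rewrite leq_mul2l /= leq_add2r.
- by rewrite (leq_trans DA) ?leq_addr.
- by rewrite (leq_trans (card_symdiff _ _)) // leq_add.
Qed.

End Restrictions.

(** * Evaluation of polynomials at Boolean points *)

Section Evaluation.
Variables (R : realFieldType) (N : nat).
Implicit Types (x : {ffun 'I_N -> bool}) (m : 'X_{1..N + N}) (p : {mpoly R[N + N]}).

Definition point x (i : 'I_(N + N)) : R :=
  match split i with inl e => (x e)%:R | inr e => (~~ x e)%:R end.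

Definition twin (l : 'I_N * bool) : 'I_(N + N) :=
  if l.2 then lshift N l.1 else rshift N l.1.

(** Exponents are forgotten, since positive powers of 0 and 1 are the numbers themselves. *)
Definition literals m : {set 'I_N * bool} := [set l | m (twin l) != 0%N].

Lemma point_twin x l : point x (twin l) = (x l.1 == l.2)%:R.
Proof.
case: l => e [] /=; rewrite /point /twin /=.
  by rewrite (unsplitK (inl e)) eqb_id.
by rewrite (unsplitK (inr e)) eqbF_neg.
Qed.

Lemma twin_onto i : exists l, i = twin l.
Proof.
case: (split_ordP i) => e ->; first by exists (e, true).
by exists (e, false).
Qed.

Lemma meval_xvar x e : (xvar R e).@[point x] = (x e)%:R.
Proof. by rewrite /xvar mevalXU (point_twin x (e, true)) eqb_id. Qed.

Lemma meval_xbar x e : (xbar R e).@[point x] = (~~ x e)%:R.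
Proof. by rewrite /xbar mevalXU (point_twin x (e, false)) eqbF_neg. Qed.

Lemma meval_lift x p1 p2 p3 e :
  [/\ (p1 * (xvar R e ^+ 2 - xvar R e)).@[point x] = 0,
      (p2 * (xbar R e ^+ 2 - xbar R e)).@[point x] = 0 &
      (p3 * (xvar R e + xbar R e - 1)).@[point x] = 0].
Proof.
have idem (b : bool) : b%:R * b%:R = b%:R :> R by rewrite -natrM mulnb andbb.
split; rewrite mevalM ?(mevalB, mevalD) ?expr2 ?mevalM ?meval1 !(meval_xvar, meval_xbar).
- by rewrite idem subrr mulr0.
- by rewrite idem subrr mulr0.
- by rewrite -natrD addnC addn_negb subrr mulr0.
Qed.

Lemma meval_parity x (Q : pred 'I_N) :
  (\prod_(i < N | Q i) (1 - 2 * xvar R i)).@[point x] = chi R [set i | Q i] x.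
Proof.
rewrite (big_morph _ (mevalM (point x)) (meval1 (point x))) /chi.
apply: eq_big => [i|i _]; first by rewrite inE.
rewrite mevalB mevalM meval_xvar meval1 mulr2n mevalD meval1.
by case: (x i); rewrite ?mulr0 ?subr0 // mulr1 opprD addrA subrr add0r.
Qed.

Variables (V : finType) (bd : {set V} -> {set 'I_N}) (F : {set 'I_N})
  (rho : {ffun 'I_N -> bool}).

Definition override x : {ffun 'I_N -> bool} :=
  [ffun e => if e \in assigned bd F then extension R bd F rho e else x e].

Lemma chi_override A x :
  chi R A (override x)
  = chi R (A :&: assigned bd F) (extension R bd F rho) * chi R (A :\: assigned bd F) x.
Proof.
rewrite (chi_setID R A (assigned bd F)); congr (_ * _); apply: eq_chi => e.
  by rewrite !inE ffunE inE => /andP[_ ->].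
by rewrite !inE ffunE inE => /andP[/negPf ->].
Qed.

(** A killed monomial evaluates to 0; a narrow one depends on at most [D] free coordinates. *)
Lemma lowdeg_monomial D m : ~~ bad bd D F rho (literals m) ->
  lowdeg D (fun x => \prod_i point (override x) i ^+ m i).
Proof.
rewrite negb_and negbK => /orP[/existsP[l /and3P[lm lF rl]]|narrow].
  apply: (lowdeg_junta (A := set0)); last by rewrite cards0.
  suff z x : \prod_i point (override x) i ^+ m i = 0 by move=> x x' _; rewrite !z.
  rewrite (bigD1 (twin l)) //= point_twin !ffunE inE /free lF /= (negPf rl).
  by move: lm; rewrite inE expr0n => /negPf ->; rewrite mul0r.
pose A := [set l.1 | l in [set l in literals m | free bd F l.1]].
apply: (lowdeg_junta (A := A)); last first.
  by rewrite (leq_trans (leq_imset_card _ _)) // leqNgt.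
move=> x x' xx'; apply: eq_bigr => i _; have [l ->] := twin_onto i.
have [->|ml] := eqVneq (m (twin l)) 0%N; first by rewrite !expr0.
rewrite !point_twin !ffunE inE; case fl: (free bd F l.1) => //=.
rewrite xx' //; apply/imsetP; exists l => //.
by rewrite !inE ml.
Qed.

Lemma lowdeg_meval D p :
  {in msupp p, forall m, ~~ bad bd D F rho (literals m)} ->
  lowdeg D (fun x => p.@[point (override x)]).
Proof.
move=> nb A DA; rewrite /fhat; under eq_bigr do rewrite mevalE.
by apply: lowdeg_sum DA => m pm; apply: lowdeg_monomial; exact: nb.
Qed.

End Evaluation.

(** * Cuts of a graph *)

Section Graph.
Variables (n : nat) (G : sgraph n).

(* For an edge, meeting [U] in an odd number of points means leaving [U]; parity
   makes [cut] additive. *)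
Definition cut (U : {set 'I_n}) : {set 'I_#|edges G|} :=
  [set i | odd #|enum_val i :&: U|].

Lemma edgeP (e : {set 'I_n}) : e \in edges G ->
  exists u v, [/\ G u v, u != v & e = [set u; v]].
Proof.
rewrite inE => /existsP[u /existsP[v /andP[uv /eqP ->]]]; exists u, v; split=> //.
by apply: contraTneq uv => ->; rewrite adj_irr.
Qed.

Lemma cutD : {morph cut : A B / A :+: B}.
Proof.
move=> A B; apply/setP=> i; rewrite !inE; move: (enum_val i) => e.
rewrite -oddD -(cardsID B (e :&: A)) -(cardsID A (e :&: B)).
have -> : e :&: B :&: A = e :&: A :&: B by rewrite setIAC.
rewrite addnACA oddD addnn odd_double /=.
have -> : e :&: (A :+: B) = (e :&: A :\: B) :|: (e :&: B :\: A).
  by apply/setP=> x; rewrite !inE; do 3!case: (_ \in _).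
have dj : (e :&: A :\: B) :&: (e :&: B :\: A) = set0.
  by apply/setP=> x; rewrite !inE; do 3!case: (_ \in _).
by rewrite cardsU dj cards0 subn0.
Qed.

Lemma cut1 u : cut [set u] = [set i : 'I_#|edges G| | u \in enum_val i].
Proof.
apply/setP=> i; rewrite !inE.
case ui: (u \in enum_val i).
  by rewrite (setIidPr _) ?cards1 // sub1set.
by rewrite setIC (disjoint_setI0 _) ?cards0 // disjoints1 ui.
Qed.

(** An edge has two points, so one that meets [U] without lying in it meets it in exactly one. *)
Lemma edge_boundary_cut U : (#|edge_boundary G U| <= #|cut U|)%N.
Proof.
rewrite -(card_imset _ (@enum_val_inj _ (mem (edges G)))); apply: subset_leq_card.
apply/subsetP=> e; rewrite inE => /and3P[eG eU neU]; apply/imsetP.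
exists (enum_rank_in eG e); last by rewrite enum_rankK_in.
rewrite inE enum_rankK_in //.
have [u [v [_ uv ee]]] := edgeP eG.
have : (#|e :&: U| < #|e|)%N.
  by rewrite proper_card // properEneq subsetIl andbT; apply: contra neU => /eqP/setIidPl.
by move: eU; rewrite -card_gt0 [#|e|](_ : _ = 2) ?ee ?cards2 ?uv //; case: #|_| => [|[|]].
Qed.

Lemma card_cut1 d u : regular d G -> (#|cut [set u]| <= d)%N.
Proof.
move=> /(_ u) <-; rewrite -(card_imset _ (@enum_val_inj _ (mem (edges G)))).
apply: (leq_trans _ (leq_imset_card (fun v => [set u; v]) [set v | G u v])).
apply: subset_leq_card; apply/subsetP=> _ /imsetP[i + ->]; rewrite cut1 inE.
have [v [w [vw _ ->]]] := edgeP (enum_valP i).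
rewrite !inE => /orP[] /eqP ->; apply/imsetP.
  by exists w; rewrite ?inE.
by exists v; [rewrite inE adj_sym | rewrite setUC].
Qed.

Lemma card_edges d : regular d G -> (#|edges G| <= n * d)%N.
Proof.
move=> regG; rewrite -[X in (X <= _)%N]card_ord -[X in (X <= _)%N]sum1_card.
apply: (@leq_trans (\sum_(u : 'I_n) #|cut [set u]|)%N); last first.
  rewrite -[X in (_ <= X * _)%N]card_ord -sum_nat_const.
  by apply: leq_sum => u _; exact: card_cut1.
under [leqRHS]eq_bigr do rewrite -sum1_card big_mkcond.
rewrite exchange_big [leqLHS]big_mkcond /=; apply: leq_sum => i _.
have [u [v [_ _ ei]]] := edgeP (enum_valP i).
by rewrite (bigD1 u) //= cut1 inE ei set21.
Qed.

Lemma meval_tseitin (R : realFieldType) u x :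
  (tseitin R G u).@[point R x] = chi R (cut [set u]) x + 1.
Proof. by rewrite /tseitin opprK mevalD meval1 meval_parity cut1. Qed.

End Graph.

(** * The lower bound on the size of refutations *)

(** Here [c * k] bounds the number of assigned edges and [D] the surviving width. The last two
    inequalities are the size conditions of [pseudo_sqr_ge0] and [pseudo_vertex]. *)
Lemma refutation_size (R : realFieldType) (n d a c D k : nat) (G : sgraph n)
    (pi : tseitin_sos_refutation R G) :
  regular d G ->
  (forall U : {set 'I_n}, (2 * #|U| <= n)%N -> (#|U| <= a * #|cut G U|)%N) ->
  (0 < c)%N -> (2 * (n * d) <= c * D)%N ->
  (8 * (a * (2 * D + c * k)) <= n)%N ->
  (4 * (1 + d * (a * (1 + c * k)) + a * (D + d + c * k)) <= n)%N ->
  (2 ^ k <= monomial_size pi)%N.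
Proof.
move=> regG expG c_gt0 cD sD sd; rewrite leqNgt; apply/negP=> small.
have expG' (U : {set 'I_n}) : (2 * #|U| <= #|'I_n|)%N -> (#|U| <= a * #|cut G U|)%N.
  by rewrite card_ord; exact: expG.
(* Exactly the polynomials counted in the size; the other summands vanish at every Boolean point. *)
pose polys := sos_free pi ++ [seq sos_eq pi u | u <- enum 'I_n].
pose ms := [seq literals m | m <- flatten [seq msupp f : seq _ | f <- polys]].
have size_ms : size ms = monomial_size pi.
  rewrite size_map size_flatten /shape -map_comp sumnE big_map big_cat /= big_map.
  by rewrite /monomial_size [X in (_ + X + _)%N]big1 ?addn0 ?big_enum // => -[].
have [F [rho [cF consF nobad]]] : exists (F : {set 'I_#|edges G|}) rho, [/\ (#|F| <= c * k)%N,
    consistent R (@cut n G) F rho & ~~ has (bad (@cut n G) D F rho) ms].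
  apply: narrow_restriction; rewrite ?size_ms //.
    exact: (consistent0 R (@cutD n G) expG').
  by rewrite (leq_trans _ cD) // card_ord leq_mul2l card_edges.
have low f : f \in polys ->
    lowdeg D (fun x => f.@[point R (override R (@cut n G) F rho x)]).
  move=> fP; apply: lowdeg_meval => m mf; apply: contra nobad => bm.
  apply/hasP; exists (literals m) => //; apply/map_f/flattenP.
  by exists (msupp f) => //; apply: map_f.
pose L := pseudo (R := R) (@cut n G) F rho.
pose ev x (p : {mpoly R[#|edges G| + #|edges G|]}) :=
  p.@[point R (override R (@cut n G) F rho x)].
have L1 : L (fun=> 1) = #|{ffun 'I_#|edges G| -> bool}|%:R.
  transitivity (L (chi R set0)); first by apply: eq_pseudo => x; rewrite chi0.
  by rewrite /L pseudo_chi (phi_set0 (@cutD n G) consF) mulr1.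
have : L (fun x => ev x (- 1)) = - #|{ffun 'I_#|edges G| -> bool}|%:R.
  rewrite -L1 /L /pseudo -sumrN; apply: eq_bigr => x _.
  by rewrite /ev mevalN meval1 mulNr.
suff : 0 <= L (fun x => ev x (- 1)).
  move=> + LN; rewrite LN oppr_ge0 lern0; apply/negP.
  by rewrite -lt0n; apply/card_gt0P; exists [ffun=> false].
have -> : L (fun x => ev x (- 1)) =
  L (fun x => \sum_(f <- sos_free pi) 1 * ev x f ^+ 2 +
              \sum_(u : 'I_n) 1 * (ev x (sos_eq pi u) * ev x (tseitin R G u))).
  apply: eq_pseudo => x; rewrite /ev (sos_identity pi) !mevalD.
  rewrite /sum_of_squares !(big_morph _ (mevalD (point R _)) (meval0 (point R _))).
  rewrite [X in _ + X + _ + _]big1 ?addr0; last by case.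
  rewrite [X in _ + (X + _ + _)]big1; last first.
    by move=> e _; have [] := meval_lift (override R (@cut n G) F rho x)
      (sos_liftx pi e) (sos_liftb pi e) (sos_liftt pi e) e.
  rewrite [X in _ + (_ + X + _)]big1; last first.
    by move=> e _; have [] := meval_lift (override R (@cut n G) F rho x)
      (sos_liftx pi e) (sos_liftb pi e) (sos_liftt pi e) e.
  rewrite [X in _ + (_ + X)]big1; last first.
    by move=> e _; have [] := meval_lift (override R (@cut n G) F rho x)
      (sos_liftx pi e) (sos_liftb pi e) (sos_liftt pi e) e.
  rewrite !addr0; congr (_ + _).
    by apply: eq_bigr => f _; rewrite expr2 mevalM mul1r expr2.
  by apply: eq_bigr => u _; rewrite mevalM mul1r.
rewrite /L pseudoD !pseudo_sum addr_ge0 //.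
  rewrite big_seq; apply: sumr_ge0 => f fP; rewrite mul1r.
  apply: (pseudo_sqr_ge0 (@cutD n G) expG' cF consF (D := D)); rewrite ?card_ord //.
  by apply: low; rewrite mem_cat fP.
(* The vertex terms are in fact 0. *)
apply: sumr_ge0 => u _; rewrite mul1r le_eqVlt eq_sym; apply/orP; left; apply/eqP.
rewrite -[RHS](pseudo_vertex (@cutD n G) expG' cF consF (card_cut1 u regG) (D := D)
  (g := fun x => ev x (sos_eq pi u))) ?card_ord //.
  by apply: eq_pseudo => x; rewrite /ev meval_tseitin chi_override.
by apply: low; rewrite mem_cat map_f ?orbT // mem_enum.
Qed.

Theorem corollary2 (R : realType) (d n0 : nat) (alpha : R)
    (G : forall n : nat, sgraph n)
    (alpha_gt0 : 0 < alpha)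
    (G_regular : forall n : nat, (n0 <= n)%N -> regular d (G n))
    (G_expander : forall n : nat, (n0 <= n)%N -> expander alpha (G n)) :
  exists eps : R, 0 < eps /\
    exists n1 : nat, forall n : nat, (n1 <= n)%N ->
      forall pi : tseitin_sos_refutation R (G n),
        2 `^ (eps * n%:R) <= (monomial_size pi)%:R.
Proof.
pose a := Num.bound alpha^-1.
have aP : 1 <= a%:R * alpha.
  by rewrite -ler_pdivrMr // div1r ltW // archi_boundP // invr_ge0 ltW.
have a_gt0 : (0 < a)%N.
  by rewrite lt0n; apply: contraTneq aP => ->; rewrite mul0r -ltNge ltr01.
(* With [D] at least [n / (128 a)], this [c] gives [2 n d <= c D], and the successor keeps it
   positive. The factor [d.+1] in [M] lets [k = n / M] absorb both [a d c k] and [a c k]. *)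
pose c := (256 * d * a).+1; pose M := (64 * a * c * d.+1)%N.
have M_gt0 : (0 < M)%N by rewrite !muln_gt0 a_gt0.
(* The factor 2 pays for rounding [n / M] down to [k]. *)
exists (2 * M)%:R^-1; split; first by rewrite invr_gt0 ltr0n muln_gt0.
(* Large enough for [k] and [D] to be positive and for the terms [8 + 16 d a] to fit below [n]. *)
exists (n0 + 2 * M + 64 * a + 8 + 16 * d * a)%N => n n_ge pi.
have n0n : (n0 <= n)%N by move: n_ge; clear; lia.
have Mn : (M <= n)%N by move: n_ge; clear; lia.
have an : (64 * a <= n)%N by move: n_ge; clear; lia.
pose k := (n %/ M)%N; pose D := (n %/ (64 * a))%N.
have kn : (k * M <= n)%N by exact: leq_divM.
have nk : (n < k.+1 * M)%N by exact: ltn_ceil.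
have Dn : (D * (64 * a) <= n)%N by exact: leq_divM.
have nD : (n < D.+1 * (64 * a))%N by apply: ltn_ceil; rewrite muln_gt0.
have k_gt0 : (0 < k)%N by rewrite divn_gt0.
have D_gt0 : (0 < D)%N by rewrite divn_gt0 ?muln_gt0.
(* Since [k >= 1], [(k + 1) M <= 2 M k]; the same rounding is used for [D]. *)
have {}nk : (n <= 2 * M * k)%N.
  by have := leq_pmulr M k_gt0; move: nk; clear; lia.
have {}nD : (n <= 128 * a * D)%N.
  by have := leq_pmulr (64 * a) D_gt0; move: nD; clear; lia.
have tn : (64 * (a * d * (c * k)) + 64 * (a * (c * k)) <= n)%N.
  by move: kn; rewrite /M; clear; lia.
clearbody k D; have cD : (2 * (n * d) <= c * D)%N.
  have := leq_mul (leqnn d) nD; rewrite /c; clear; lia.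
have {Dn} aD : (64 * (a * D) <= n)%N by move: Dn; clear; lia.
have {}n_ge : (8 + 16 * (d * a) <= n)%N by move: n_ge; clear; lia.
have size_pi : (2 ^ k <= monomial_size pi)%N.
  apply: (@refutation_size _ _ d a c D) => //.
  - exact: G_regular.
  - move=> U sU; rewrite -(ler_nat R); apply: le_trans (ler_peMl (ler0n _ _) aP) _.
    rewrite -mulrA natrM ler_wpM2l ?ler0n //.
    by rewrite (le_trans (G_expander _ n0n _ sU)) // ler_nat edge_boundary_cut.
  - by move: tn aD; clear; lia.
  - by move: tn aD n_ge; clear; lia.
apply: (@le_trans _ _ (2 `^ k%:R)); last first.
  by rewrite powR_mulrn ?ler0n // -natrX ler_nat.
apply: ler_powR; first by rewrite ler1n.
by rewrite mulrC ler_pdivrMr ?ltr0n ?muln_gt0 // -natrM ler_nat mulnC.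
Qed.
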